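(* Let $\gamma=\frac{a}{5L}$ for any $a\le 1$ (with $a>0$, so that the step size $\gamma$ is positive). Then Sparse SAGA with step size $\gamma$ converges geometrically in expectation with a rate factor of at least $\rho(a)=\frac15\min\{\frac1n,a\frac{1}{\kappa}\}$; that is, for $x_t$ obtained after $t$ updates, $$\mathbb{E}\|x_t-x^*\|^2\le (1-\rho)^t\,C_0,$$ where $\rho=\rho(a)$ and $C_0:=\|x_0-x^*\|^2+\frac{1}{5L^2}\sum_{i=1}^n\|\alpha_i^0-f_i'(x^* )\|^2$.
   Context: Let $f(x)=\frac1n\sum_{i=1}^n f_i(x)$ on $\mathbb{R}^d$, where each $f_i$ is convex and differentiable with $L$-Lipschitz gradient $f_i'$, and $f$ is $\mu$-strongly convex ($\mu>0$). Let $\kappa:=L/\mu$ and let $x^*$ be the minimizer of $f$. $\|\cdot\|$ is the Euclidean norm. For each $i$, $S_i\subseteq\{1,\dots,d\}$ is the support of $f_i'$, i.e. the set of coordinates where $f_i'$ can be nonzero. $P_{S_i}$ is the coordinate projection onto $S_i$. $p_v$ is the probability that $v\in S_i$ when $i$ is uniformly random in $\{1,\dots,n\}$, i.e. $p_v=\frac1n|\{i: v\in S_i\}|$; $D$ is the $d\times d$ diagonal matrix with diagonal entries $1/p_v$; $D_i:=P_{S_i}D$. Sparse SAGA (sequential algorithm). It maintains an iterate $x\in\mathbb{R}^d$, initialized at $x_0$, and a memory table $(\alpha_i)_{i=1}^n$ of historical gradients (vectors in $\mathbb{R}^d$), where $\alpha_i$ is initialized at $\alpha_i^0$, which can be any convenient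 value (typically $0$). At each update it samples $i$ uniformly at random in $\{1,\dots,n\}$ (independently of the past), and with $\bar\alpha:=\frac1n\sum_{j=1}^n\alpha_j$ it performs $$x^+=x-\gamma\big(f_i'(x)-\alpha_i+D_i\bar\alpha\big),\qquad \alpha_i^+=f_i'(x),$$ where the right-hand sides use the values before the update, and the other $\alpha_j$ are unchanged.
   Formalization: The initial memory values α_i^0 are assumed to vanish outside the support S_i (as 0 and all gradients f_i' do); for arbitrary α_i^0 the bound fails, e.g. d=1, f_1=Lx²/2, the other f_i=0, x_0=0, α_1^0=0, α_i^0=b≠0 for i≥2, n=100. *)

(* Defs.v *)
From HB Require Import structures.
From mathcomp Require Import all_boot all_order all_algebra.
From mathcomp Require Import finmap.
From mathcomp Require Import all_classical all_reals all_analysis.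

Set Implicit Arguments.
Unset Strict Implicit.
Unset Printing Implicit Defensive.

Import Order.TTheory GRing.Theory Num.Theory.
Import numFieldNormedType.Exports.

Local Open Scope classical_set_scope.
Local Open Scope ring_scope.

Section Optimization.
Context {R : realType} {d : nat}.
Implicit Types (f : 'cV[R]_d -> R) (x y : 'cV[R]_d).

(* The norm `|x| that the library puts on matrices is the sup norm. *)
Definition enorm x : R := Num.sqrt (\sum_v x v ord0 ^+ 2).

Definition grad f x : 'cV[R]_d := \col_v 'D_(delta_mx v ord0) f x.

Definition lipschitz_grad (L : R) f : Prop :=
  forall x y, enorm (grad f x - grad f y) <= L * enorm (x - y).

Definition strongly_convex (mu : R) f : Prop :=
  forall x y (t : R), 0 <= t <= 1 ->
    f (t *: x + (1 - t) *: y) <=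
    t * f x + (1 - t) * f y - mu / 2%:R * t * (1 - t) * enorm (x - y) ^+ 2.

Definition minimizer f x : Prop := forall y, f x <= f y.

Definition coord_proj (S : {set 'I_d}) : 'M[R]_d :=
  diag_mx (\row_v (v \in S)%:R).

End Optimization.

Section SparseSAGA.
Context {R : realType} {d n : nat}.
Variable f : 'I_n -> 'cV[R]_d -> R.

Definition avg_fun (x : 'cV[R]_d) : R := n%:R^-1 * \sum_i f i x.

Definition supp (i : 'I_n) : {set 'I_d} :=
  [set v : 'I_d | `[< exists x, grad (f i) x v ord0 != 0 >]]%SET.

Definition pcoord (v : 'I_d) : R := #|[set i : 'I_n | v \in supp i]%SET|%:R / n%:R.

Definition Dmx : 'M[R]_d := diag_mx (\row_v (pcoord v)^-1).

Definition Dimx (i : 'I_n) : 'M[R]_d := coord_proj (supp i) *m Dmx.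

(* A state is the iterate together with the table of historical gradients. *)
Definition saga_state : Type := ('cV[R]_d * ('I_n -> 'cV[R]_d))%type.

Definition saga_step (gamma : R) (i : 'I_n) (s : saga_state) : saga_state :=
  let: (x, alpha) := s in
  let alphabar := n%:R^-1 *: \sum_j alpha j in
  (x - gamma *: (grad (f i) x - alpha i + Dimx i *m alphabar),
   fun j => if j == i then grad (f i) x else alpha j).

Fixpoint sparse_saga (gamma : R) (x0 : 'cV[R]_d) (alpha0 : 'I_n -> 'cV[R]_d)
    (idx : nat -> 'I_n) (t : nat) : saga_state :=
  if t is t'.+1
  then saga_step gamma (idx t') (sparse_saga gamma x0 alpha0 idx t')
  else (x0, alpha0).

End SparseSAGA.

Section Sampling.
Context {R : realType} {disp : measure_display} {T : measurableType disp}.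
Variables (P : probability T R) (n : nat) (I : nat -> T -> 'I_n).

(* Every subset of the finite type 'I_n is measurable. *)
Definition measurable_draws : Prop :=
  forall k (A : set 'I_n), measurable (I k @^-1` A).

Definition uniform_draws : Prop :=
  forall k j, P (I k @^-1` [set j]) = (n%:R^-1)%:E.

Definition independent_draws : Prop :=
  forall (J : {fset nat}) (A : nat -> set 'I_n),
    P (\bigcap_(k in [set` J]) (I k @^-1` A k)) =
    (\prod_(k <- J) P (I k @^-1` A k))%E.

Definition iid_uniform : Prop :=
  [/\ measurable_draws, uniform_draws & independent_draws].

End Sampling.

(* Main.v *)
(** The Lyapunov function is [|x - xs|^2 + c sum_i |alpha_i - grad f_i xs|^2].
    Reweighting by [D_i] keeps the update an unbiased gradient estimate, and the
    correction [D_i alphabar] only lowers the second moment of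
    [alpha_i - grad f_i xs].  Co-coercivity of the gradients bounds the remaining
    second moment by [L <grad f x, x - xs>], so this one scalar product, which
    dominates [mu |x - xs|^2], pays for all error terms and the Lyapunov
    function contracts by [1 - rho] on average over the sampled index.  The
    draws being uniform and independent, the expectation after [t] updates is
    the mean over the [n^t] index sequences. *)

Require Import Defs.
From HB Require Import structures.
From mathcomp Require Import all_boot all_order all_algebra.
From mathcomp Require Import finmap ring lra.
From mathcomp Require Import all_classical all_reals all_analysis measurable_realfun.

Set Implicit Arguments.
Unset Strict Implicit.
Unset Printing Implicit Defensive.

Import Order.TTheory GRing.Theory Num.Theory.
Import numFieldNormedType.Exports.

Local Open Scope classical_set_scope.
Local Open Scope ring_scope.

(** * The Euclidean inner product on column vectors *)

Section InnerProduct.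
Context {R : realType} {d : nat}.
Implicit Types u v w : 'cV[R]_d.

Definition dotp u v : R := \sum_k u k ord0 * v k ord0.

Lemma dotpC u v : dotp u v = dotp v u.
Proof. by apply: eq_bigr => k _; rewrite mulrC. Qed.

Lemma dotpDl u v w : dotp (u + v) w = dotp u w + dotp v w.
Proof. by rewrite -big_split; apply: eq_bigr => k _; rewrite mxE mulrDl. Qed.

Lemma dotpZl a u w : dotp (a *: u) w = a * dotp u w.
Proof. by rewrite mulr_sumr; apply: eq_bigr => k _; rewrite mxE mulrA. Qed.

Lemma dotp0l w : dotp 0 w = 0.
Proof. by rewrite -(scale0r 0) dotpZl mul0r. Qed.

Lemma dotpNl u w : dotp (- u) w = - dotp u w.
Proof. by rewrite -scaleN1r dotpZl mulN1r. Qed.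

Lemma dotpBl u v w : dotp (u - v) w = dotp u w - dotp v w.
Proof. by rewrite dotpDl dotpNl. Qed.

Lemma dotpDr u v w : dotp w (u + v) = dotp w u + dotp w v.
Proof. by rewrite !(dotpC w) dotpDl. Qed.

Lemma dotpZr a u w : dotp w (a *: u) = a * dotp w u.
Proof. by rewrite !(dotpC w) dotpZl. Qed.

Lemma dotpNr u w : dotp w (- u) = - dotp w u.
Proof. by rewrite !(dotpC w) dotpNl. Qed.

Lemma dotpBr u v w : dotp w (u - v) = dotp w u - dotp w v.
Proof. by rewrite !(dotpC w) dotpBl. Qed.

Lemma dotpBB u v : dotp (u - v) (u - v) = dotp u u - 2 * dotp u v + dotp v v.
Proof. by rewrite dotpBl !dotpBr (dotpC v u); ring. Qed.

Lemma dotp_suml (J : finType) (F : J -> 'cV[R]_d) w :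
  dotp (\sum_j F j) w = \sum_j dotp (F j) w.
Proof.
rewrite exchange_big; apply: eq_bigr => k _.
by rewrite summxE mulr_suml.
Qed.

Lemma dotp_ge0 u : 0 <= dotp u u.
Proof. by apply: sumr_ge0 => k _; rewrite -expr2 sqr_ge0. Qed.

Lemma dotp_eq0 u : dotp u u = 0 -> u = 0.
Proof.
move=> u0; apply/colP => k; apply/eqP; rewrite mxE -sqrf_eq0 expr2.
have /psumr_eq0P -> // : dotp u u = 0 by [].
by move=> j _; rewrite -expr2 sqr_ge0.
Qed.

(** Expand [|u - c v|^2 >= 0]. This stands in for Cauchy-Schwarz below, and [c] may be negative. *)
Lemma dotp_young c u v : 2 * c * dotp u v <= dotp u u + c ^+ 2 * dotp v v.
Proof.
have := dotp_ge0 (u - c *: v).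
by rewrite dotpBB !dotpZl !dotpZr; lra.
Qed.

Lemma enorm_sqr u : enorm u ^+ 2 = dotp u u.
Proof.
rewrite /enorm sqr_sqrtr; last by apply: sumr_ge0 => k _; rewrite sqr_ge0.
by apply: eq_bigr => k _; rewrite expr2.
Qed.

Lemma lipschitz_grad_sqr (L : R) (f : 'cV[R]_d -> R) x y : lipschitz_grad L f ->
  dotp (grad f x - grad f y) (grad f x - grad f y)
    <= L ^+ 2 * dotp (x - y) (x - y).
Proof.
move=> /(_ x y) lip; rewrite -!enorm_sqr -exprMn.
by rewrite lerXn2r ?nnegrE ?sqrtr_ge0// (le_trans _ lip) ?sqrtr_ge0.
Qed.

End InnerProduct.

(** * Tangent inequalities, the descent lemma and co-coercivity *)

Section ConvexAnalysis.
Context {R : realType} {d : nat}.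
Implicit Types (f : 'cV[R]_d -> R) (x y u : 'cV[R]_d).

Lemma derive_dotp f x u : differentiable f x -> 'D_u f x = dotp (grad f x) u.
Proof.
move=> df; rewrite deriveE// [in LHS](matrix_sum_delta u) linear_sum.
apply: eq_bigr => k _; rewrite big_ord1 linearZ /= -deriveE// mxE.
by rewrite mulrC (ord1 ord0).
Qed.

Lemma is_derive_line f x u (s : R) : differentiable f (x + s *: u) ->
  is_derive s 1 (fun r : R => f (x + r *: u)) (dotp (grad f (x + s *: u)) u).
Proof.
move=> df; rewrite -derive_dotp//.
have E : (fun h : R => h^-1 *: (((fun r : R => f (x + r *: u)) \o shift s) (h *: 1)
     - f (x + s *: u)))
  = (fun h : R => h^-1 *: ((f \o shift (x + s *: u)) (h *: u) - f (x + s *: u))).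
  apply/funext => h /=; rewrite [h *: 1]mulr1 scalerDl.
  by rewrite [x + _]addrCA.
split; last by rewrite /derive E.
by rewrite /derivable E; exact: diff_derivable.
Qed.

(** Dividing by [s] bounds the difference quotient by [A + s * B]; let [s] tend to 0 from the right.
    The [B] term absorbs the second-order part of strong convexity. *)
Lemma derive_le_secant (phi : R -> R) (D A B : R) : is_derive (0 : R) 1 phi D ->
  (forall s, 0 < s <= 1 -> phi s - phi 0 <= s * A + s ^+ 2 * B) -> D <= A.
Proof.
move=> [dphi <-] phi_le.
have lhs : (fun h : R => h^-1 *: ((phi \o shift 0) (h *: 1) - phi 0)) @ 0^'+
    --> 'D_1 phi 0.
  move=> S /dphi; rewrite /= !nbhs_simpl /at_right /dnbhs /within/=.
  by apply: filterS => h Sh h0; apply: Sh; rewrite gt_eqF.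
have rhs : (fun h : R => A + h * B) @ 0^'+ --> A.
  have : (fun h : R => A + h * B) @ 0 --> A + 0 * B.
    by apply: cvgD; [exact: cvg_cst|apply: cvgM; [exact: cvg_id|exact: cvg_cst]].
  rewrite mul0r addr0; exact: cvg_at_right_filter.
apply: ler_cvg_to lhs rhs _; near=> h.
have h0 : 0 < h by near: h; exact: nbhs_right_gt.
have h1 : h <= 1 by near: h; exact: nbhs_right_le.
have := phi_le h; rewrite h0 h1 => /(_ isT) le_h.
rewrite /= [h *: 1]mulr1 addr0 [_ *: _]mulrC ler_pdivrMr//.
by apply: (le_trans le_h); rewrite le_eqVlt; apply/orP; left; apply/eqP; ring.
Unshelve. all: by end_near.
Qed.

(** Write the convexity inequality at [x + r (y - x)], divide by [r] and let [r] tend to 0. The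
    slope [D] stays abstract so that the same lemma serves each [f i] (with [mu = 0]) and
    [avg_fun f], whose slope is a mean of gradients. *)
Lemma strongly_convex_tangent (mu : R) f x y (D : R) : strongly_convex mu f ->
  is_derive (0 : R) 1 (fun s : R => f (x + s *: (y - x))) D ->
  f x + D + mu / 2 * dotp (y - x) (y - x) <= f y.
Proof.
move=> cf df.
suff : D <= f y - f x - mu / 2 * dotp (y - x) (y - x) by lra.
apply: (derive_le_secant (B := mu / 2 * dotp (y - x) (y - x)) df) => r /andP[r0 r1].
have := cf y x r; rewrite (ltW r0) r1 => /(_ isT).
rewrite enorm_sqr (_ : r *: y + (1 - r) *: x = x + r *: (y - x)); last first.
  by apply/colP => k; rewrite !mxE; ring.
rewrite scale0r addr0 => le_r.
apply: (le_trans (lerB le_r (lexx _))).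
by rewrite le_eqVlt; apply/orP; left; apply/eqP; ring.
Qed.

Lemma convex_strongly_convex0 f :
  convex_function [set: 'cV[R]_d] f -> strongly_convex 0 f.
Proof.
move=> cf x y t /andP[t0 t1].
have := cf (Itv01 t0 t1) x y (in_setT _) (in_setT _).
by rewrite convRE /= !mul0r subr0.
Qed.

Lemma convex_tangent f x y : convex_function [set: 'cV[R]_d] f ->
  differentiable f x -> f x + dotp (grad f x) (y - x) <= f y.
Proof.
move=> /convex_strongly_convex0 cf df.
have df0 : differentiable f (x + 0 *: (y - x)) by rewrite scale0r addr0.
have := strongly_convex_tangent cf (is_derive_line df0).
by rewrite scale0r addr0 !mul0r addr0.
Qed.

(** Along the segment, [psi] is [f] minus its quadratic model, up to a constant; the mean value
    theorem reduces the claim to [psi' c <= 0] at one interior point. *)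
Lemma descent_lemma (L : R) f x y : 0 < L -> (forall z, differentiable f z) ->
  lipschitz_grad L f ->
  f y <= f x + dotp (grad f x) (y - x) + L / 2 * dotp (y - x) (y - x).
Proof.
move=> L0 df lip; set u := y - x; set N := dotp u u; set A := dotp (grad f x) u.
pose psi (s : R) : R := f (x + s *: u) - (s * A + s ^+ 2 * (L / 2 * N)).
pose psi' (s : R) : R := dotp (grad f (x + s *: u)) u - (A + s * (L * N)).
have dpsi (s : R) : is_derive s 1 psi (psi' s).
  have ? := is_derive_line (df (x + s *: u)).
  apply: is_derive_eq; rewrite /psi' /=.
  by rewrite !scaler0 !add0r /GRing.scale/=; field.
have [c] : exists2 c, c \in `]0, 1[%R & psi 1 - psi 0 = psi' c * (1 - 0).
  apply: MVT => // s; apply: derivable_within_continuous => z _.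
  exact: ex_derive.
rewrite in_itv/= => /andP[c0 c1].
rewrite /psi scale1r scale0r addr0 (_ : x + u = y) => [psiE|]; last first.
  by rewrite addrC subrK.
suff : psi' c <= 0 by move: psiE; lra.
have [w wE] : {w | w = grad f (x + c *: u) - grad f x}.
  by exists (grad f (x + c *: u) - grad f x).
have ww : dotp w w <= L ^+ 2 * (c ^+ 2 * N).
  have := lipschitz_grad_sqr (x + c *: u) x lip.
  by rewrite (addrAC x) subrr add0r dotpZl dotpZr [c * _]mulrA -expr2 wE.
have -> : psi' c = dotp w u - c * L * N.
  by rewrite /psi' wE dotpBl -/A; ring.
(* With weight [c L] the two squares are each at most [c^2 L^2 N], so [c L <w, u> <= c^2 L^2 N],
   which is [c L psi' <= 0]. *)
have := dotp_young (c * L) w u; rewrite -/N exprMn => young.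
have cL : 0 < c * L by rewrite mulr_gt0.
by rewrite -(pmulr_lle0 _ cL); move: ww young; nra.
Qed.

(** [key] sharpens the tangent inequality by [|w|^2 / (2 L)]; adding its instances for [(x, y)] and
    [(y, x)] cancels the function values. *)
Lemma cocoercive (L : R) f x y : 0 < L -> (forall z, differentiable f z) ->
  convex_function [set: 'cV[R]_d] f -> lipschitz_grad L f ->
  dotp (grad f x - grad f y) (grad f x - grad f y)
    <= L * dotp (grad f x - grad f y) (x - y).
Proof.
move=> L0 df cf lip.
have key a b w : w = grad f b - grad f a ->
    f a + dotp (grad f a) (b - a) + (2 * L)^-1 * dotp w w <= f b.
  (* [z] minimizes the quadratic upper model at [b] of [f - <grad f a, .>]. Its value is bounded
     above by the descent lemma from [b] and below by the tangent at [a]. *)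
  move=> wE; pose z := b - L^-1 *: w.
  have := descent_lemma b z L0 df lip.
  have := convex_tangent z cf (df a).
  have -> : z - b = - (L^-1 *: w) by rewrite /z addrC addKr.
  have -> : z - a = (b - a) - L^-1 *: w by rewrite /z addrAC.
  have -> : grad f b = grad f a + w by rewrite wE addrC subrK.
  rewrite !dotpDl (dotpDr (b - a)) !dotpNr !dotpNl opprK !dotpZr !dotpZl.
  have -> : L / 2 * (L^-1 * (L^-1 * dotp w w)) = (2 * L)^-1 * dotp w w.
    by field; rewrite gt_eqF.
  have -> : L^-1 * dotp w w = 2 * ((2 * L)^-1 * dotp w w).
    by field; rewrite gt_eqF.
  by lra.
have [w wE] : {w | w = grad f x - grad f y} by exists (grad f x - grad f y).
have := key y x w wE; have := key x y (- w); rewrite wE opprB => /(_ erefl).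
rewrite -opprB -wE dotpNl dotpNr opprK.
have -> : dotp (grad f y) (x - y) = dotp (grad f x) (x - y) - dotp w (x - y).
  by rewrite wE dotpBl; ring.
have E : dotp w w = L * (2 * ((2 * L)^-1 * dotp w w)) by field; rewrite gt_eqF.
by rewrite -[y - x]opprB dotpNr => le1 le2; rewrite [leLHS]E ler_pM2l//; lra.
Qed.

End ConvexAnalysis.

(** * Sums over the sampled index: gradients, supports and the reweighting [D_i] *)

Section SparseSAGAStep.
Context {R : realType} {d n : nat}.
Variable f : 'I_n -> 'cV[R]_d -> R.
Hypothesis n_gt0 : (0 < n)%N.

Lemma is_derive_avg_fun x u : (forall i, differentiable (f i) x) ->
  is_derive (0 : R) 1 (fun s : R => avg_fun f (x + s *: u))
    (n%:R^-1 * dotp (\sum_i grad (f i) x) u).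
Proof.
move=> df.
have dl i : is_derive (0 : R) 1 (fun s : R => f i (x + s *: u)) (dotp (grad (f i) x) u).
  have := @is_derive_line _ _ (f i) x u 0.
  by rewrite scale0r addr0; exact.
have := is_deriveZ n%:R^-1 (is_derive_sum dl).
rewrite dotp_suml; congr is_derive; apply/funext => s.
by rewrite /avg_fun /= fct_sumE.
Qed.

(** In direction [- g] the mean has slope [- |g|^2 / n], and minimality forbids a negative slope. *)
Lemma sum_grad_minimizer xs : (forall i, differentiable (f i) xs) ->
  minimizer (avg_fun f) xs -> \sum_i grad (f i) xs = 0.
Proof.
move=> df min_xs; set g := \sum_i _; apply: dotp_eq0; apply/eqP.
rewrite eq_le dotp_ge0 andbT.
have dN : is_derive (0 : R) 1 (fun s : R => - avg_fun f (xs + s *: - g))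
    (- (n%:R^-1 * dotp g (- g))) := is_deriveN (is_derive_avg_fun (- g) df).
have n_inv : 0 < n%:R^-1 :> R by rewrite invr_gt0 ltr0n.
suff : - (n%:R^-1 * dotp g (- g)) <= 0.
  by rewrite dotpNr mulrN opprK pmulr_rle0.
apply: (derive_le_secant (B := 0) dN) => s _ /=.
rewrite scale0r addr0 !mulr0 addr0 opprK addrC subr_le0.
exact: min_xs.
Qed.

(** Add the tangent inequalities at [x] and at [xs]: each contributes [mu / 2], and the slope at
    [xs] vanishes. *)
Lemma strongly_convex_minimizer (mu : R) x xs :
  (forall i z, differentiable (f i) z) ->
  strongly_convex mu (avg_fun f) -> minimizer (avg_fun f) xs ->
  n%:R * mu * dotp (x - xs) (x - xs)
    <= dotp (\sum_i grad (f i) x) (x - xs).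
Proof.
move=> df sc min_xs.
have n_gt : 0 < n%:R :> R by rewrite ltr0n.
have le1 := strongly_convex_tangent sc (is_derive_avg_fun (xs - x) (df^~ x)).
have := strongly_convex_tangent sc (is_derive_avg_fun (x - xs) (df^~ xs)).
rewrite sum_grad_minimizer// dotp0l mulr0 addr0 => le2.
move: le1; rewrite -[xs - x]opprB dotpNl !dotpNr opprK => le1.
rewrite -mulrA mulrC -ler_pdivlMr// [leRHS]mulrC [leLHS]mulrC; lra.
Qed.

Lemma grad_notin_supp i v x : v \notin supp f i -> grad (f i) x v ord0 = 0.
Proof.
rewrite inE => /asboolPn vS; apply/eqP/negPn/negP => gx.
by apply: vS; exists x.
Qed.

Lemma sum_in_supp v : \sum_i (v \in supp f i)%:R = n%:R * pcoord f v :> R.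
Proof.
rewrite /pcoord mulrC divfK ?pnatr_eq0 -?lt0n// -natr_sum; congr _%:R.
by rewrite -sum1dep_card [RHS]big_mkcond; apply: eq_bigr => i _; case: (v \in _).
Qed.

Lemma Dimx_mulE i (y : 'cV[R]_d) v :
  (Dimx f i *m y) v ord0 = (v \in supp f i)%:R * ((pcoord f v)^-1 * y v ord0).
Proof. by rewrite /Dimx /coord_proj /Dmx -mulmxA !mul_diag_mx !mxE. Qed.

(** The invariant of the table that makes the reweighting unbiased; every gradient table satisfies
    it. *)
Definition supported (alpha : 'I_n -> 'cV[R]_d) : Prop :=
  forall i v, v \notin supp f i -> alpha i v ord0 = 0.

Lemma supported_mul alpha i v : supported alpha ->
  (v \in supp f i)%:R * alpha i v ord0 = alpha i v ord0.
Proof. by move=> sa; have [_|/sa ->] := boolP (v \in _); rewrite ?mul1r ?mulr0. Qed.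

(** Coordinate [v] survives the projection for [n p_v] of the indices, which cancels the weight
    [1 / p_v]. *)
Lemma sum_Dimx_mean alpha : supported alpha ->
  \sum_i Dimx f i *m (n%:R^-1 *: \sum_j alpha j) = \sum_j alpha j.
Proof.
move=> sa; apply/colP => v; rewrite summxE.
under eq_bigr do rewrite Dimx_mulE.
rewrite -mulr_suml sum_in_supp mxE.
(* If [p_v = 0], no support contains [v], so both sides vanish. *)
have [p0|p0] := eqVneq (pcoord f v) 0; last first.
  by field; rewrite p0 pnatr_eq0 -lt0n n_gt0.
rewrite p0 mulr0 mul0r summxE big1// => j _; apply: sa.
have := sum_in_supp v; rewrite p0 mulr0.
move=> /psumr_eq0P -/(_ (fun _ _ => ler0n _ _)) /(_ j isT).
by move/eqP; rewrite pnatr_eq0 eqb0.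
Qed.

(* As in E|X - EX|^2 <= E|X|^2, coordinate by coordinate. *)
Lemma sum_Dimx_variance beta : supported beta ->
  \sum_i dotp (beta i - Dimx f i *m (n%:R^-1 *: \sum_j beta j))
              (beta i - Dimx f i *m (n%:R^-1 *: \sum_j beta j))
  <= \sum_i dotp (beta i) (beta i).
Proof.
move=> sb; set y := _ *: _.
rewrite exchange_big [leRHS]exchange_big; apply: ler_sum => v _.
pose p := pcoord f v.
have sumb : \sum_i beta i v ord0 = n%:R * y v ord0.
  by rewrite mxE mulrA mulfV ?mul1r ?summxE// pnatr_eq0 -lt0n.
have ge0 : 0 <= n%:R * (p^-1 * y v ord0 ^+ 2).
  by apply: mulr_ge0 => //; apply: mulr_ge0; rewrite ?sqr_ge0 ?invr_ge0 ?divr_ge0.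
suff -> : \sum_i (beta i - Dimx f i *m y) v ord0 * (beta i - Dimx f i *m y) v ord0
    = \sum_i beta i v ord0 * beta i v ord0 - n%:R * (p^-1 * y v ord0 ^+ 2).
  by rewrite gerBl.
(* [r] is what every index with [v] in its support subtracts. The cross term below carries no
   indicator because [beta] is supported. *)
pose r := p^-1 * y v ord0.
transitivity (\sum_i (beta i v ord0 * beta i v ord0 - 2 * r * beta i v ord0
   + (v \in supp f i)%:R * r ^+ 2)).
  apply: eq_bigr => i _.
  have -> : (beta i - Dimx f i *m y) v ord0 = beta i v ord0 - (v \in supp f i)%:R * r.
    by rewrite !mxE -Dimx_mulE mxE.
  have := supported_mul i v sb.
  by case: (v \in _) => /= [_|]; [|rewrite mul0r => <-]; ring.
rewrite !big_split /= sumrN -mulr_sumr -mulr_suml sumb sum_in_supp -/p.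
have -> : r ^+ 2 = p^-1 * p^-1 * y v ord0 ^+ 2 by rewrite /r; ring.
(* This holds for [p = 0] too, since [0^-1 = 0]. *)
have pp : p * (p^-1 * p^-1) = p^-1.
  by have [->|p0] := eqVneq p 0; [rewrite invr0 !mul0r|rewrite mulrA mulfV// mul1r].
have -> : n%:R * p * (p^-1 * p^-1 * y v ord0 ^+ 2) = n%:R * (p^-1 * y v ord0 ^+ 2).
  by rewrite -[in RHS]pp; ring.
by rewrite /r; ring.
Qed.

End SparseSAGAStep.

(** * One-step contraction of the Lyapunov function *)

Section Contraction.
Context {R : realType} {d n : nat}.
Variables (f : 'I_n -> 'cV[R]_d -> R) (L mu : R) (xs : 'cV[R]_d).
Hypotheses (n_gt0 : (0 < n)%N) (L_gt0 : 0 < L) (mu_gt0 : 0 < mu).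
Hypotheses (f_convex : forall i, convex_function [set: 'cV[R]_d] (f i))
  (f_diff : forall i x, differentiable (f i) x)
  (f_lip : forall i, lipschitz_grad L (f i))
  (f_sconvex : strongly_convex mu (avg_fun f))
  (xs_min : minimizer (avg_fun f) xs).

Definition table_error (alpha : 'I_n -> 'cV[R]_d) : R :=
  \sum_i dotp (alpha i - grad (f i) xs) (alpha i - grad (f i) xs).

Definition lyapunov (c : R) (s : saga_state) : R :=
  dotp (s.1 - xs) (s.1 - xs) + c * table_error s.2.

(** Each entry is refreshed for exactly one of the [n] sampled indices and kept for the other
    [n - 1]. *)
Lemma sum_table_error x alpha :
  \sum_i table_error (fun j => if j == i then grad (f i) x else alpha j)
  = n%:R * table_error alpha - table_error alpha
    + \sum_i dotp (grad (f i) x - grad (f i) xs) (grad (f i) x - grad (f i) xs).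
Proof.
have -> : n%:R * table_error alpha = \sum_(i < n) table_error alpha.
  by rewrite sumr_const card_ord mulr_natl.
rewrite -sumrB -big_split /=; apply: eq_bigr => i _.
rewrite /table_error (bigD1 i)//= [in RHS](bigD1 i)//= eqxx.
rewrite (eq_bigr (fun j => dotp (alpha j - grad (f j) xs) (alpha j - grad (f j) xs))).
  by ring.
by move=> j /negPf ->.
Qed.

(** Expand [|e - gamma v_i|^2]. The cross term is exact by unbiasedness; the square is split as
    [u i] minus a recentred table error, whose sum of squares the variance bound controls. *)
Lemma sum_saga_step_dist gamma x alpha : supported f alpha ->
  \sum_i dotp ((saga_step f gamma i (x, alpha)).1 - xs)
              ((saga_step f gamma i (x, alpha)).1 - xs)
  <= n%:R * dotp (x - xs) (x - xs)
     - 2 * gamma * dotp (\sum_i grad (f i) x) (x - xs)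
     + gamma ^+ 2
       * (2 * \sum_i dotp (grad (f i) x - grad (f i) xs) (grad (f i) x - grad (f i) xs)
          + 2 * table_error alpha).
Proof.
move=> sa; set e := x - xs; set y := n%:R^-1 *: \sum_j alpha j.
pose v i := grad (f i) x - alpha i + Dimx f i *m y.
pose u i := grad (f i) x - grad (f i) xs.
pose beta i := alpha i - grad (f i) xs.
(* The gradients at [xs] sum to 0, so centring the table leaves [alphabar] unchanged. *)
have sum_beta : \sum_i beta i = \sum_i alpha i.
  by rewrite sumrB (sum_grad_minimizer n_gt0 (f_diff^~ xs) xs_min) subr0.
have sum_v : \sum_i v i = \sum_i grad (f i) x.
  by rewrite big_split sumrB (sum_Dimx_mean n_gt0)//= subrK.
have supp_beta : supported f beta.
  by move=> i k ik; rewrite mxE sa// add0r mxE grad_notin_supp// oppr0.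
have le_v i : dotp (v i) (v i) <= 2 * dotp (u i) (u i)
    + 2 * dotp (beta i - Dimx f i *m y) (beta i - Dimx f i *m y).
  have -> : v i = u i - (beta i - Dimx f i *m y).
    by apply/colP => k; rewrite !mxE; ring.
  have := dotp_young (-1) (u i) (beta i - Dimx f i *m y).
  by rewrite (dotpBB (u i)); lra.
have le_var : \sum_i dotp (beta i - Dimx f i *m y) (beta i - Dimx f i *m y)
    <= table_error alpha.
  by rewrite /y -sum_beta; exact: (sum_Dimx_variance n_gt0).
have -> : \sum_i dotp ((saga_step f gamma i (x, alpha)).1 - xs)
     ((saga_step f gamma i (x, alpha)).1 - xs)
   = n%:R * dotp e e - 2 * gamma * dotp (\sum_i v i) e
     + gamma ^+ 2 * \sum_i dotp (v i) (v i).
  rewrite dotp_suml.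
  have -> : n%:R * dotp e e = \sum_(i < n) dotp e e.
    by rewrite sumr_const card_ord mulr_natl.
  rewrite !mulr_sumr -sumrB -big_split /=; apply: eq_bigr => i _.
  rewrite -/y -/(v i) (_ : _ - xs = e - gamma *: v i); last by rewrite addrAC.
  by rewrite (dotpBB e) !dotpZl !dotpZr (dotpC e); ring.
rewrite sum_v lerD2l ler_wpM2l ?sqr_ge0//.
apply: (le_trans (ler_sum _ (fun i _ => le_v i))).
by rewrite big_split /= -!mulr_sumr lerD2l ler_wpM2l.
Qed.

(* With [c = k a / L^2], the table-error terms require [a / 10 <= k] and the
   scalar-product terms [k <= 3 / 25]. *)
Lemma saga_step_contraction (a rho : R) s : 0 < a -> a <= 1 ->
  5 * n%:R * rho <= 1 -> 5 * L * rho <= a * mu -> supported f s.2 ->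
  let c := 3 * a / (25 * L ^+ 2) in
  \sum_i lyapunov c (saga_step f (a / (5 * L)) i s)
    <= n%:R * ((1 - rho) * lyapunov c s).
Proof.
case: s => x alpha a0 a1 rho1 rho2 /= sa; set c := _ / _; set gamma := a / _.
rewrite big_split /= -mulr_sumr sum_table_error.
have le_dist := sum_saga_step_dist gamma x sa.
have le_G := strongly_convex_minimizer n_gt0 x f_diff f_sconvex xs_min.
have : \sum_i dotp (grad (f i) x - grad (f i) xs) (grad (f i) x - grad (f i) xs)
   <= L * dotp (\sum_i grad (f i) x) (x - xs).
  have -> : \sum_i grad (f i) x = \sum_i (grad (f i) x - grad (f i) xs).
    by rewrite sumrB (sum_grad_minimizer n_gt0 (f_diff^~ xs) xs_min) subr0.
  rewrite dotp_suml mulr_sumr; apply: ler_sum => i _.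
  exact: cocoercive.
move: le_dist le_G; rewrite /lyapunov /=.
set E := dotp (x - xs) (x - xs); set G := dotp (\sum_i grad (f i) x) (x - xs).
set U := \sum_i dotp (grad (f i) x - grad (f i) xs) _.
set H := table_error alpha => le_dist le_G le_U.
have E0 : 0 <= E by exact: dotp_ge0.
have H0 : 0 <= H by apply: sumr_ge0 => i _; exact: dotp_ge0.
have n1 : 1 <= n%:R :> R by rewrite ler1n.
apply: (le_trans (lerD le_dist (lexx _))).
pose l := L^-1; have l0 : 0 < l by rewrite invr_gt0.
have lL : l * L = 1 by rewrite mulVf ?gt_eqF.
have gE : gamma = a * l / 5 by rewrite /gamma /l; field; rewrite gt_eqF.
have cE : c = 3 * a * l ^+ 2 / 25 by rewrite /c /l; field; rewrite gt_eqF.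
have al : 0 < a * l by rewrite mulr_gt0.
(* Co-coercivity trades [U] for [L G]. Half of [2 gamma G] pays for [n rho E] by strong convexity,
   and the other half for [U]. *)
have le_GU : (2 * gamma ^+ 2 + c) * U <= 2 * gamma * G - n%:R * rho * E.
  have c1 : 0 <= 2 * gamma ^+ 2 + c by rewrite gE cE; nra.
  apply: (le_trans (ler_wpM2l c1 le_U)).
  have -> : (2 * gamma ^+ 2 + c) * (L * G) = (a * l) * (2 * a / 25 + 3 / 25) * G.
    by rewrite gE cE; transitivity ((a * l) * (2 * a / 25 + 3 / 25) * ((l * L) * G));
      [field|rewrite lL mul1r].
  have nE : 0 <= n%:R * E by rewrite mulr_ge0.
  have rhoE : n%:R * rho * E <= a * l / 5 * (n%:R * mu * E).
    have -> : n%:R * rho * E = (n%:R * E) * (l / 5) * (5 * L * rho).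
      by transitivity (n%:R * rho * E * (l * L)); [rewrite lL mulr1|field].
    have -> : a * l / 5 * (n%:R * mu * E) = (n%:R * E) * (l / 5) * (a * mu) by field.
    by rewrite ler_wpM2l// mulr_ge0// divr_ge0// ltW.
  have G0 : 0 <= G by apply: le_trans le_G; rewrite !mulr_ge0// ltW.
  have al5 : 0 <= a * l / 5 by rewrite divr_ge0// ltW.
  have := ler_wpM2l al5 le_G.
  (* The slack that remains is [2 / 25] of this product; here [a <= 1] enters. *)
  have : a * l * (1 - a) * G >= 0 by rewrite !mulr_ge0 ?subr_ge0// ltW.
  by rewrite gE; lra.
(* Refreshing one entry frees [c H], which covers both [2 gamma^2 H] and the loss [n rho c H]
   because [n rho <= 1 / 5]. *)
have le_H : 2 * gamma ^+ 2 * H - c * H <= - (n%:R * rho * c * H).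
  have -> : 2 * gamma ^+ 2 * H - c * H = - ((3 / 25 - 2 * a / 25) * (a * l ^+ 2 * H)).
    by rewrite gE cE; field.
  have -> : n%:R * rho * c * H = (3 / 25 * (n%:R * rho)) * (a * l ^+ 2 * H).
    by rewrite cE; field.
  rewrite lerN2; apply: ler_wpM2r; last lra.
  by apply: mulr_ge0 => //; apply: mulr_ge0; [exact: ltW|exact: sqr_ge0].
by move: le_GU le_H; lra.
Qed.

End Contraction.

(** * Expectation over the draws as a finite mean *)

Section Sampling.
Context {R : realType} {disp : measure_display} {T : measurableType disp}.
Variables (P : probability T R) (n : nat) (I : nat -> T -> 'I_n).
Hypothesis iidI : iid_uniform P I.

Definition draws t (w : T) : t.-tuple 'I_n := [tuple I k w | k < t].

Lemma nth_draws t w i0 k : (k < t)%N -> nth i0 (draws t w) k = I k w.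
Proof. by move=> kt; exact: (nth_mktuple _ i0 (Ordinal kt)). Qed.

(** Puts the event in the form of a finite intersection over times, to which [independent_draws]
    applies. *)
Lemma draws_preimage t (s : t.-tuple 'I_n) (i0 : 'I_n) :
  draws t @^-1` [set s]
  = \bigcap_(k in [set` [fset k in iota 0 t]%fset]) (I k @^-1` [set nth i0 s k]).
Proof.
apply/seteqP; split => w /=.
  move=> <- k /=; rewrite inE/= mem_iota/= add0n => kt.
  by rewrite nth_draws.
move=> wA; apply: eq_from_tnth => k; rewrite tnth_mktuple (tnth_nth i0).
by apply: wA; rewrite /= inE/= mem_iota/= add0n.
Qed.

Lemma draws_measurable t (s : t.-tuple 'I_n) : measurable (draws t @^-1` [set s]).
Proof.
have [mI _ _] := iidI.
(* The empty tuple has no entry to serve as default for [nth]; its event is the whole space. *)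
case: t s => [|t] s.
  rewrite (_ : _ @^-1` _ = setT)//; apply/seteqP; split => // w _ /=.
  by rewrite tuple0 [RHS]tuple0.
rewrite (draws_preimage s (thead s)); apply: bigcap_measurableType => k _.
exact: mI.
Qed.

Lemma draws_prob t (s : t.-tuple 'I_n) :
  P (draws t @^-1` [set s]) = (n%:R^-1 ^+ t)%:E.
Proof.
have [_ uI indI] := iidI.
case: t s => [|t] s.
  rewrite (_ : _ @^-1` _ = setT) ?probability_setT//.
  by apply/seteqP; split => // w _ /=; rewrite tuple0 [RHS]tuple0.
rewrite (draws_preimage s (thead s)).
rewrite (indI _ (fun k => [set nth (thead s) s k])).
under eq_bigr do rewrite uI.
rewrite prodEFin; congr _%:E; rewrite big_const_seq count_predT.
by rewrite card_fseq undup_id ?iota_uniq// size_iota -/(GRing.exp _ _) iter_mulr_1.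
Qed.

(** [phi] of the draws is a finite combination of indicators of events of equal probability.
    Nonnegativity lets the integral pass through the sum without integrability conditions. *)
Lemma expectation_draws t (phi : t.-tuple 'I_n -> R) : (forall s, 0 <= phi s) ->
  ('E_P[fun w => phi (draws t w)] = (n%:R^-1 ^+ t * \sum_s phi s)%:E)%E.
Proof.
move=> phi0; pose A s := draws t @^-1` [set s].
rewrite unlock.
transitivity (\int[P]_w (\sum_s ((phi s)%:E * (\1_(A s) w)%:E)))%E.
  apply: eq_integral => w _; rewrite (bigD1 (draws t w))//= big1 => [|s sw].
    by rewrite indicE mem_set// mule1 adde0.
  by rewrite indicE memNset ?mule0// /A/= => ws; rewrite ws eqxx in sw.
rewrite ge0_integral_sum//; last first.
- by move=> s w _; rewrite mule_ge0 ?lee_fin.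
- move=> s; apply: measurable_funeM; apply/measurable_EFinP.
  exact/measurable_indic/draws_measurable.
rewrite mulr_sumr -sumEFin; apply: eq_bigr => s _.
rewrite ge0_integralZl_EFin//; last first.
  by apply/measurable_EFinP; exact/measurable_indic/draws_measurable.
rewrite integral_indic ?setIT//; last exact: draws_measurable.
by rewrite mulrC EFinM; congr (_ * _)%E; exact: draws_prob.
Qed.

End Sampling.

(** * Iterating the contraction along index sequences *)

Lemma big_tuple_rcons (V : nmodType) (J : finType) t (F : t.+1.-tuple J -> V) :
  \sum_s F s = \sum_(s : t.-tuple J) \sum_j F [tuple of rcons s j].
Proof.
rewrite pair_big /= (reindex (fun p : t.-tuple J * J => [tuple of rcons p.1 p.2]))//.
apply: onW_bij; apply: inj_card_bij.
  move=> [s j] [s' j'] /(congr1 val)/= /eqP; rewrite eqseq_rcons.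
  move=> /andP[/eqP ss' /eqP ->].
  by congr pair; apply: val_inj.
by rewrite card_prod !card_tuple expnSr.
Qed.

Section Trajectory.
Context {R : realType} {d n : nat}.
Variables (f : 'I_n -> 'cV[R]_d -> R) (gamma : R).
Variables (x0 : 'cV[R]_d) (alpha0 : 'I_n -> 'cV[R]_d).

Lemma eq_sparse_saga idx idx' t : (forall k, (k < t)%N -> idx k = idx' k) ->
  sparse_saga f gamma x0 alpha0 idx t = sparse_saga f gamma x0 alpha0 idx' t.
Proof.
elim: t => //= t IH eq_idx; rewrite eq_idx// IH// => k kt.
exact/eq_idx/ltnW.
Qed.

Lemma sparse_saga_supported idx t : supported f alpha0 ->
  supported f (sparse_saga f gamma x0 alpha0 idx t).2.
Proof.
move=> sa0; elim: t => //= t; case: sparse_saga => x alpha /= sa i v iv.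
by case: eqP iv => [-> iv|_ /sa//]; exact: grad_notin_supp.
Qed.

(** Induction on [t]: the last index is summed out first, with the state [S s] fixed by the earlier
    ones. The default [i0] is never read, as only positions below [t] are used. *)
Lemma sum_sparse_saga_contraction (V : saga_state -> R) (r : R) (i0 : 'I_n) t :
  0 <= r -> supported f alpha0 ->
  (forall s, supported f s.2 ->
    \sum_i V (saga_step f gamma i s) <= n%:R * (r * V s)) ->
  \sum_(s : t.-tuple 'I_n) V (sparse_saga f gamma x0 alpha0 (nth i0 s) t)
    <= n%:R ^+ t * (r ^+ t * V (x0, alpha0)).
Proof.
move=> r0 sa0 contr; elim: t => [|t IH].
  rewrite !expr0 !mul1r (big_pred1 [tuple])// => s.
  by apply/esym/eqP; exact: tuple0.
rewrite big_tuple_rcons.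
pose S (s : t.-tuple 'I_n) := sparse_saga f gamma x0 alpha0 (nth i0 s) t.
have stepE (s : t.-tuple 'I_n) i :
    sparse_saga f gamma x0 alpha0 (nth i0 [tuple of rcons s i]) t.+1
    = saga_step f gamma i (S s).
  rewrite /= nth_rcons size_tuple ltnn eqxx; congr saga_step.
  by apply: eq_sparse_saga => k kt; rewrite nth_rcons size_tuple kt.
apply: (@le_trans _ _ (\sum_(s : t.-tuple 'I_n) n%:R * (r * V (S s)))).
  apply: ler_sum => s _; under eq_bigr do rewrite stepE.
  exact/contr/sparse_saga_supported.
rewrite -!mulr_sumr !exprS -!mulrA ler_wpM2l//.
rewrite [leRHS]mulrCA ler_wpM2l//.
Qed.

End Trajectory.

(** * The convergence rate in expectation *)

Theorem theorem2 (R : realType) (d n : nat) (hn : (0 < n)%N)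
    (f : 'I_n -> 'cV[R]_d -> R) (L mu : R) (hL : 0 < L) (hmu : 0 < mu)
    (f_convex : forall i, convex_function [set: 'cV[R]_d] (f i))
    (f_diff : forall i x, differentiable (f i) x)
    (f_lip : forall i, lipschitz_grad L (f i))
    (f_sconvex : strongly_convex mu (avg_fun f))
    (xs : 'cV[R]_d) (hxs : minimizer (avg_fun f) xs)
    (x0 : 'cV[R]_d) (alpha0 : 'I_n -> 'cV[R]_d)
    (alpha0_supp : forall i v, v \notin supp f i -> alpha0 i v ord0 = 0)
    (disp : measure_display) (T : measurableType disp) (P : probability T R)
    (I : nat -> T -> 'I_n) (hI : iid_uniform P I)
    (a : R) (ha0 : 0 < a) (ha1 : a <= 1) (t : nat) :
  let gamma := a / (5%:R * L) in
  let kappa := L / mu in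
  let rho := 5%:R^-1 * Num.min (n%:R^-1) (a * kappa^-1) in
  let C0 := enorm (x0 - xs) ^+ 2
            + (5%:R * L ^+ 2)^-1
              * \sum_i enorm (alpha0 i - grad (f i) xs) ^+ 2 in
  let x w := (sparse_saga f gamma x0 alpha0 (fun k => I k w) t).1 in
  ('E_P[(fun w => enorm (x w - xs) ^+ 2)%R] <= ((1 - rho) ^+ t * C0)%:E)%E.
Proof.
lazy zeta; set gamma := a / (5 * L); set kappa := L / mu.
set rho := 5^-1 * Num.min _ _; set C0 := enorm (x0 - xs) ^+ 2 + _.
pose x w := (sparse_saga f gamma x0 alpha0 (fun k => I k w) t).1.
rewrite -[X in 'E_P[X]%E]/(fun w => enorm (x w - xs) ^+ 2).
pose i0 := Ordinal hn.
pose c := 3 * a / (25 * L ^+ 2).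
have n_gt : 0 < n%:R :> R by rewrite ltr0n.
have L2_ge0 : 0 <= 25 * L ^+ 2 by rewrite mulr_ge0// sqr_ge0.
have c_ge0 : 0 <= c by rewrite divr_ge0// mulr_ge0// ltW.
have minV : rho <= 5^-1 * n%:R^-1 /\ rho <= 5^-1 * (a * kappa^-1).
  by split; rewrite ler_wpM2l ?invr_ge0// ge_min lexx ?orbT.
have rho1 : 5 * n%:R * rho <= 1.
  rewrite [leRHS](_ : _ = 5 * n%:R * (5^-1 * n%:R^-1)); last first.
    by field; rewrite gt_eqF.
  by rewrite ler_wpM2l ?mulr_ge0 ?minV.1.
have rho2 : 5 * L * rho <= a * mu.
  have -> : a * mu = 5 * L * (5^-1 * (a * kappa^-1)).
    by rewrite /kappa; field; rewrite !gt_eqF.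
  by rewrite ler_wpM2l ?minV.2// mulr_ge0// ltW.
have rho_le1 : 0 <= 1 - rho.
  have n1 : n%:R^-1 <= 1 :> R by rewrite invf_le1// ler1n.
  by have := minV.1; lra.
pose traj (s : t.-tuple 'I_n) := sparse_saga f gamma x0 alpha0 (nth i0 s) t.
pose phi (s : t.-tuple 'I_n) := dotp ((traj s).1 - xs) ((traj s).1 - xs).
have -> : (fun w => enorm (x w - xs) ^+ 2) = (fun w => phi (draws I t w)).
  apply/funext => w; rewrite enorm_sqr /phi /traj /x.
  rewrite (@eq_sparse_saga _ _ _ _ _ _ _ _ (nth i0 (draws I t w)))// => k kt.
  by rewrite nth_draws.
rewrite expectation_draws => [|//|s]; last exact: dotp_ge0.
rewrite lee_fin exprVn [leLHS]mulrC ler_pdivrMr ?exprn_gt0//.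
(* The squared distance is the Lyapunov function without its nonnegative table term. *)
apply: (@le_trans _ _ (\sum_s lyapunov f xs c (traj s))).
  apply: ler_sum => s _; rewrite lerDl mulr_ge0// sumr_ge0// => i _.
  exact: dotp_ge0.
apply: le_trans (sum_sparse_saga_contraction _ _ _ rho_le1 alpha0_supp _) _.
  by move=> s ss; apply: (saga_step_contraction (mu := mu) (L := L)).
rewrite [leRHS]mulrC ler_wpM2l ?exprn_ge0// ler_wpM2l ?exprn_ge0//.
rewrite /C0 /lyapunov /table_error enorm_sqr lerD2l.
under [in leRHS]eq_bigr do rewrite enorm_sqr.
apply: ler_wpM2r; first by apply: sumr_ge0 => i _; exact: dotp_ge0.
(* The stated weight [1 / (5 L^2)] dominates [c], since [3 a <= 5]. *)
have -> : (5 * L ^+ 2)^-1 = 5 / (25 * L ^+ 2) by field; rewrite gt_eqF.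
by rewrite ler_wpM2r ?invr_ge0//; lra.
Qed.
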